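(* Let $a\in\mathbb{C}\setminus\{-2,-3,-4,\ldots\}$ and let $\tilde L_a:\omega\to\omega$ be the linear map on the space $\omega$ of all complex sequences given by $$\tilde L_a(x)_n=\sum_{k=0}^n\frac{(-n)_k}{(1+a+n)_k}\,x_k,\qquad n\ge 0.$$ Then $\tilde L_a$ is invertible, and for every $x\in\omega$: (a) if $a\in\mathbb{C}\setminus\{0,-1,-2,-3,\ldots\}$, $$\tilde L_a^{-1}(x)_n=\frac{(a)_n\left(1+\frac a2\right)_n}{n!\left(\frac a2\right)_n}\sum_{k=0}^n\frac{(-n)_k(n+a)_k}{k!\,(1+a)_k}\,x_k,\qquad n\ge 0;$$ (b) if $a=0$, $\tilde L_0^{-1}(x)_0=x_0$ and $\tilde L_0^{-1}(x)_n=2\sum_{k=0}^n\frac{(-n)_k(n)_k}{k!\,k!}x_k$ for $n>0$; (c) if $a=-1$, $\tilde L_{-1}^{-1}(x)_0=x_0$ and $\tilde L_{-1}^{-1}(x)_n=(2n-1)\sum_{k=0}^n\frac{(-1)^k(k)_{n-1}}{(n-k)!\,k!}x_k$ for $n>0$.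
   Context: For $\gamma\in\mathbb{C}$ and an integer $k\ge 0$, the rising factorial is $(\gamma)_0=1$ and $(\gamma)_k=\gamma(\gamma+1)\cdots(\gamma+k-1)$ for $k>0$. $\omega$ denotes the complex vector space of all sequences $(x_n)_{n=0}^\infty$ of complex numbers. *)

(* Defs.v *)
From HB Require Import structures.
From mathcomp Require Import all_boot all_order all_algebra.
From mathcomp Require Import complex.
From mathcomp Require Import all_classical reals.

Set Implicit Arguments.
Unset Strict Implicit.
Unset Printing Implicit Defensive.

Import GRing.Theory.
Local Open Scope ring_scope.

(* The rising factorial gamma (gamma + 1) ... (gamma + k - 1). *)
Definition poch (K : pzRingType) (gamma : K) (k : nat) : K :=
  \prod_(i < k) (gamma + i%:R).

(* All complex sequences, with the pointwise R[i]-module structure. *)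
Notation omega R := (nat -> R[i]).

Definition Ltilde (R : realType) (a : R[i]) (x : omega R) : omega R :=
  fun n => \sum_(k < n.+1) poch (- n%:R) k / poch (1 + a + n%:R) k * x k.

Lemma Ltilde_is_linear (R : realType) (a : R[i]) :
  linear (Ltilde a : omega R -> omega R).
Proof.
move=> c x y; apply/funext => n.
change (Ltilde a (c *: x + y) n = c * Ltilde a x n + Ltilde a y n).
rewrite /Ltilde mulr_sumr -big_split /=; apply: eq_bigr => k _.
by rewrite [X in _ * X = _](_ : _ = c * x k + y k) // mulrDr mulrCA.
Qed.

HB.instance Definition _ (R : realType) (a : R[i]) :=
  GRing.isLinear.Build R[i] (omega R) (omega R) _ (Ltilde a)
    (Ltilde_is_linear a).

(* Main.v *)
(** The matrix (-n)_k / (1+a+n)_k of the operator is lower triangular. The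
    (n,j) entry, j < n, of the product of its candidate inverse with it is
    (a+2n) / (n-j)! times
    sum_i (-1)^i binom(n-j, i) (1+a+2j+i)_(n-1-j),
    which is a finite difference of order n-j of a polynomial of degree n-j-1,
    hence zero. A left inverse of a triangular matrix by a triangular one is
    also a right inverse, as is seen on finite truncations. *)

From HB Require Import structures.
Require Import Defs.
From mathcomp Require Import all_boot all_order all_algebra.
From mathcomp Require Import complex.
From mathcomp Require Import all_classical reals.
From mathcomp Require Import ring zify.
Import GRing.Theory Num.Theory.
Local Open Scope ring_scope.

Set Implicit Arguments.
Unset Strict Implicit.
Unset Printing Implicit Defensive.

(** * Rising factorials and their finite differences *)

Section Pochhammer.
Variable F : numFieldType.
Implicit Types c a : F.

Lemma poch0 c : poch c 0 = 1.
Proof. by rewrite /poch big_ord0. Qed.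

Lemma pochSr c k : poch c k.+1 = poch c k * (c + k%:R).
Proof. by rewrite /poch big_ord_recr. Qed.

Lemma pochD c j k : poch c (j + k) = poch c j * poch (c + j%:R) k.
Proof.
elim: k => [|k IHk]; first by rewrite addn0 poch0 mulr1.
by rewrite addnS !pochSr IHk natrD mulrA addrA.
Qed.

Lemma pochSl c k : poch c k.+1 = c * poch (c + 1) k.
Proof. by rewrite -add1n pochD pochSr poch0 mul1r addr0. Qed.

Lemma poch_neq0 c k :
  (forall i, (i < k)%N -> c + i%:R != 0) -> poch c k != 0.
Proof. by move=> c_neq0; apply/prodf_neq0 => i _; exact: c_neq0. Qed.

Lemma ffactnD n j i : (n ^_ (j + i) = n ^_ j * (n - j) ^_ i)%N.
Proof.
elim: i => [|i IHi]; first by rewrite addn0 ffactn0 muln1.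
by rewrite addnS !ffactnSr IHi subnDA mulnA.
Qed.

(** The falling factorial vanishes for k > n, which is why the matrix of the operator is
    triangular. *)
Lemma poch_oppn n k : poch (- n%:R : F) k = (-1) ^+ k * (n ^_ k)%:R.
Proof.
elim: k => [|k IHk]; first by rewrite poch0 ffactn0 mulr1.
rewrite pochSr IHk ffactnSr natrM exprS.
have [le_kn|lt_nk] := leqP k n; last by rewrite ffact_small //; ring.
by rewrite natrB //; ring.
Qed.

Lemma poch1 n : poch (1 : F) n = n`!%:R.
Proof.
elim: n => [|n IHn]; first by rewrite poch0.
by rewrite pochSr IHn factS mulnC natrM -natr1 addrC.
Qed.

(** The factor (c+1)_r is common to both products and leaves c - (c+1+r), so differencing lowers the
    degree by one. *)
Lemma poch_diff c r :
  poch c r.+1 - poch (c + 1) r.+1 = - r.+1%:R * poch (c + 1) r.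
Proof. by rewrite pochSl pochSr -natr1; ring. Qed.

(* The sum is the m-th finite difference of a polynomial in k of degree r. *)
Lemma sum_alternating_poch m r c : (r < m)%N ->
  \sum_(k < m.+1) (-1) ^+ k * 'C(m, k)%:R * poch (c + k%:R) r = 0.
Proof.
elim: m r c => // m IHm r c; rewrite ltnS => le_rm.
(* Pascal's rule writes a difference of order m+1 as the difference of order m of a first
   difference. *)
have -> : \sum_(k < m.+2) (-1) ^+ k * 'C(m.+1, k)%:R * poch (c + k%:R) r =
    \sum_(k < m.+1) (-1) ^+ k * 'C(m, k)%:R *
      (poch (c + k%:R) r - poch (c + k%:R + 1) r).
  under [RHS]eq_bigr do rewrite mulrBr.
  rewrite sumrB big_ord_recl [X in _ = X - _]big_ord_recl /= !bin0 -addrA.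
  congr (_ + _).
  under eq_bigr => k _.
    rewrite /bump /= add1n binS natrD mulrDr mulrDl; over.
  rewrite big_split /=; congr (_ + _).
    by rewrite big_ord_recr /= bin_small // mulr0 mul0r addr0.
  rewrite -sumrN; apply: eq_bigr => k _.
  by rewrite exprS -natr1 addrA !mulN1r !mulNr.
case: r le_rm => [|r] le_rm.
  by apply: big1 => k _; rewrite !poch0 subrr mulr0.
under eq_bigr do rewrite poch_diff mulrCA -[c + _ + 1]addrAC.
by rewrite -mulr_sumr IHm // mulr0.
Qed.

End Pochhammer.

(** * Operators given by infinite lower triangular matrices *)

Section LowerTriangular.
Variable F : numFieldType.
Implicit Types (A B : nat -> nat -> F) (x : nat -> F).

Definition lower A x : nat -> F := fun n => \sum_(k < n.+1) A n k * x k.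

Definition triangular A := forall n k, (n < k)%N -> A n k = 0.

(** Gives all rows a common length, so that double sums can be exchanged and rows read off N x N
    truncations. *)
Lemma lower_widen A x n N : triangular A -> (n < N)%N ->
  lower A x n = \sum_(k < N) A n k * x k.
Proof.
move=> trA lt_nN; rewrite /lower (big_ord_widen N (fun k => A n k * x k)) //.
rewrite big_mkcond; apply: eq_bigr => k _.
by case: ltnP => // lt_nk; rewrite trA ?mul0r.
Qed.

Lemma lowerK A B : triangular A ->
    (forall n j, \sum_(k < n.+1) B n k * A k j = (n == j)%:R) ->
  cancel (lower A) (lower B).
Proof.
move=> trA BA x; apply/funext => n; rewrite {1}/lower.
under eq_bigr => k _ do rewrite (@lower_widen _ _ _ n.+1) // mulr_sumr.
transitivity (\sum_(j < n.+1) (n == j)%:R * x j).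
  rewrite exchange_big; apply: eq_bigr => j _.
  by rewrite -BA mulr_suml; apply: eq_bigr => k _; rewrite mulrA.
rewrite big_ord_recr /= eqxx mul1r big1 ?add0r // => j _.
by rewrite gtn_eqF ?mul0r.
Qed.

Lemma triangular_mulC A B : triangular A -> triangular B ->
    (forall n j, \sum_(k < n.+1) B n k * A k j = (n == j)%:R) ->
  forall n j, \sum_(k < n.+1) A n k * B k j = (n == j)%:R.
Proof.
move=> trA trB BA n j.
(* The truncation must contain both indices; for square matrices a left inverse is a right
   inverse. *)
pose N := (maxn n j).+1.
have lt_nN : (n < N)%N by rewrite ltnS leq_maxl.
have lt_jN : (j < N)%N by rewrite ltnS leq_maxr.
pose MA : 'M_N := \matrix_(p, q) A p q; pose MB : 'M_N := \matrix_(p, q) B p q.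
have MBA : MB *m MA = 1%:M.
  apply/matrixP => p q; rewrite !mxE -(BA p q).
  rewrite -[RHS]/(lower B (A^~ q) p) (lower_widen _ trB (ltn_ord p)).
  by apply: eq_bigr => k _; rewrite !mxE.
have /matrixP/(_ (Ordinal lt_nN) (Ordinal lt_jN)) := mulmx1C MBA.
rewrite !mxE -val_eqE /= => <-.
rewrite -[LHS]/(lower A (B^~ j) n) (lower_widen _ trA lt_nN).
by apply: eq_bigr => k _; rewrite !mxE.
Qed.

End LowerTriangular.

Lemma lower_is_linear (R : realType) (A : nat -> nat -> R[i]) :
  linear (lower A : omega R -> omega R).
Proof.
move=> c x y; apply/funext => n.
change (lower A (c *: x + y) n = c * lower A x n + lower A y n).
rewrite /lower mulr_sumr -big_split /=; apply: eq_bigr => k _.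
by rewrite [X in _ * X = _](_ : _ = c * x k + y k) // mulrDr mulrCA.
Qed.

HB.instance Definition _ (R : realType) (A : nat -> nat -> R[i]) :=
  GRing.isLinear.Build R[i] (omega R) (omega R) _ (lower A)
    (lower_is_linear A).

(** * The matrix of the operator and its inverse matrix *)

Section Kernels.
Variables (F : numFieldType) (a : F).

Definition kerA n k : F := poch (- n%:R) k / poch (1 + a + n%:R) k.

(* Putting [(a)_n (n+a)_k / (a (1+a)_k) = (1+a+k)_(n-1)] in the generic
   formula removes the poles at a = 0 and a = -1. *)
Definition kerB n k : F :=
  if n == 0%N then (k == 0%N)%:R
  else (a + 2 * n%:R) * poch (- n%:R) k * poch (1 + a + k%:R) n.-1 /
       (k`!%:R * n`!%:R).

Lemma kerA_triangular : triangular kerA.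
Proof.
by move=> n k lt_nk; rewrite /kerA poch_oppn ffact_small // mulr0 mul0r.
Qed.

Lemma kerB_triangular : triangular kerB.
Proof.
move=> n k lt_nk; rewrite /kerB; case: eqP => [n0|_].
  by move: lt_nk; rewrite n0 lt0n => /negPf ->.
by rewrite poch_oppn ffact_small // mulr0 mulr0 !mul0r.
Qed.

Hypothesis a_neq : forall m, (2 <= m)%N -> a + m%:R != 0.

(** The factors are a + (n+i+1) with i < k <= n. Any such factor forces n >= 1, so the shift is at
    least 2. *)
Lemma poch_den_neq0 n k : (k <= n)%N -> poch (1 + a + n%:R) k != 0.
Proof.
move=> le_kn; apply: poch_neq0 => i lt_ik.
have -> : 1 + a + n%:R + i%:R = a + (n + i).+1%:R by rewrite -natr1 natrD; ring.
by apply: a_neq; case: n le_kn; lia.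
Qed.

Lemma fact_neq0 n : n`!%:R != 0 :> F.
Proof. by rewrite pnatr_eq0 -lt0n fact_gt0. Qed.

(* [(-n)_k (-k)_j / k! = (-1)^(k-j) (n)(n-1)...(n-j+1) binom(n-j, k-j)] *)
Lemma kerBA_term n j i : (0 < n)%N ->
  kerB n (j + i) * kerA (j + i) j =
    (a + 2 * n%:R) * (n ^_ j)%:R / n`!%:R * ((-1) ^+ i * 'C(n - j, i)%:R *
     (poch (1 + a + (j + i)%:R) n.-1 / poch (1 + a + (j + i)%:R) j)).
Proof.
move=> n_gt0; rewrite /kerA /kerB gtn_eqF //.
have -> : ((j + i)`!%:R : F) = ((j + i) ^_ j)%:R * i`!%:R.
  by rewrite -natrM -{3}(addKn j i) ffact_fact ?leq_addr.
have jfact : (((j + i) ^_ j)%:R : F) != 0.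
  by rewrite pnatr_eq0 -lt0n ffact_gt0 leq_addr.
rewrite !poch_oppn exprD.
rewrite ffactnD -(bin_ffact (n - j) i) !natrM.
(* The left side carries (-1)^j twice; the same square is put on the right for [field] to match. *)
have signK z : z = (-1) ^+ j * (-1) ^+ j * z :> F.
  by rewrite -exprMn mulrNN mulr1 expr1n mul1r.
have i0 := fact_neq0 i; have n0 := fact_neq0 n.
(* With its inverse kept opaque, [field] does not ask for this factor to be nonzero. *)
move: (poch _ j) => Q; rewrite [RHS]signK.
move: Q^-1 => q.
by field; rewrite n0 jfact i0.
Qed.

Lemma kerBA n j : \sum_(k < n.+1) kerB n k * kerA k j = (n == j)%:R.
Proof.
have [lt_nj|le_jn] := ltnP n j.
  rewrite ltn_eqF // big1 // => k _.
  by rewrite kerA_triangular ?mulr0 // (leq_trans (ltn_ord k)).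
have [->|n_gt0] := posnP n.
  rewrite big_ord_recr big_ord0 /= add0r /kerB /kerA /= mul1r poch_oppn.
  case: j {le_jn} => [|j]; first by rewrite !poch0 !mul1r invr1.
  by rewrite ffact_small // mulr0 mul0r.
have -> : \sum_(k < n.+1) kerB n k * kerA k j =
    \sum_(i < (n - j).+1) kerB n (j + i) * kerA (j + i) j.
  rewrite -(big_mkord xpredT (fun k => kerB n k * kerA k j)).
  rewrite (@big_cat_nat _ _ _ j) //=; last exact: leqW.
  rewrite big_nat big1 ?add0r => [|k /andP[_ lt_kj]]; last first.
    by rewrite kerA_triangular ?mulr0.
  rewrite -{1}[j]add0n big_addn big_mkord subSn //.
  by apply: eq_bigr => i _; rewrite addnC.
under eq_bigr do rewrite kerBA_term //.
rewrite -mulr_sumr.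
have [eq_nj|lt_jn] := eqVneq n j.
  (* On the diagonal only i = 0 remains, and a+2n cancels the last factor of (1+a+n)_n. *)
  rewrite -eq_nj subnn big_ord_recr big_ord0 /= add0r addn0 ffactnn.
  have := @poch_den_neq0 n n (leqnn n); have := fact_neq0 n.
  case: n n_gt0 {le_jn eq_nj} => // n _ /= fn0.
  rewrite pochSr mulf_eq0 negb_or bin0.
  have -> : 1 + a + n.+1%:R + n%:R = a + 2 * n.+1%:R by rewrite -natr1; ring.
  by case/andP; move: (poch _ n) (a + _) => p q p0 q0; field; rewrite p0 q0 fn0.
have {}lt_jn : (j < n)%N by rewrite ltn_neqAle eq_sym lt_jn.
(* Dividing (1+a+j+i)_(n-1) by its first j factors leaves (1+a+2j+i)_(n-j-1), of degree below n-j in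
   i. *)
have En : n.-1 = (j + (n - j).-1)%N by lia.
under eq_bigr => i _.
  rewrite En pochD [poch _ j * _]mulrC mulfK; last first.
    by rewrite poch_den_neq0 ?leq_addr.
  have -> : 1 + a + (j + i)%:R + j%:R = 1 + a + j%:R + j%:R + i%:R.
    by rewrite natrD; ring.
  over.
by rewrite sum_alternating_poch ?mulr0 // prednK ?subn_gt0.
Qed.

Lemma kerAB n j : \sum_(k < n.+1) kerA n k * kerB k j = (n == j)%:R.
Proof. exact: triangular_mulC kerA_triangular kerB_triangular kerBA n j. Qed.

End Kernels.

(** * Closed forms of the inverse matrix in the three cases *)

Section ClosedForms.
Variable F : numFieldType.
Implicit Types a : F.

Lemma lowerB0 a x : lower (kerB a) x 0%N = x 0%N.
Proof. by rewrite /lower big_ord1 /kerB mul1r. Qed.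

Lemma kerB_generic a n k : (forall m, a + m%:R != 0) ->
  kerB a n k = poch a n * poch (1 + a / 2) n / (n`!%:R * poch (a / 2) n) *
    (poch (- n%:R) k * poch (n%:R + a) k / (k`!%:R * poch (1 + a) k)).
Proof.
move=> a_neq; have a0 : a != 0 by have := a_neq 0%N; rewrite addr0.
have p1 : poch (1 + a) k != 0.
  by apply: poch_neq0 => i _; rewrite addrAC addrC nat1r.
have p2 : poch (a / 2) n != 0.
  apply: poch_neq0 => i _; have -> : a / 2 + i%:R = (a + (2 * i)%:R) / 2.
    by rewrite natrM; field.
  by rewrite mulf_neq0 ?invr_eq0 ?pnatr_eq0.
have fk := fact_neq0 F k; have fn := fact_neq0 F n.
(* Obtained by splitting off either the first or the last factor of (a/2)_(n+1). *)
have half : poch (1 + a / 2) n = poch (a / 2) n * (a + 2 * n%:R) / a.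
  have := pochSl (a / 2) n; rewrite pochSr [_ / 2 + 1]addrC => E.
  apply: (@mulfI _ (a / 2)); first by rewrite mulf_neq0 ?invr_eq0 ?pnatr_eq0.
  by rewrite -E; field.
rewrite half /kerB; case: n p2 fn {half} => [|n] p2 fn /=.
  rewrite !poch0 fact0 mulr0 addr0 poch_oppn.
  case: k p1 fk => [|k] p1 fk; last first.
    by rewrite ffact_small // !(mulr0, mul0r).
  by rewrite /= !poch0 fact0 expr0 ffactn0; field.
(* Both sides are (a)_(n+1+k), where n is now the predecessor of the row index. *)
have key : poch a n.+1 * poch (n.+1%:R + a) k =
    a * (poch (1 + a) k * poch (1 + a + k%:R) n).
  by rewrite [n.+1%:R + a]addrC -!pochD addSn pochSl addnC [a + 1]addrC.
have -> : poch (1 + a + k%:R) n =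
    poch a n.+1 * poch (n.+1%:R + a) k / (a * poch (1 + a) k).
  by rewrite key; field; rewrite p1 a0.
by field; rewrite a0 fk fn p1 p2.
Qed.

Lemma kerB_0 n k : (0 < n)%N ->
  kerB (0 : F) n k = 2 * (poch (- n%:R) k * poch n%:R k / (k`!%:R * k`!%:R)).
Proof.
case: n => // n _; rewrite /kerB /= add0r addr0 factS natrM.
have fk := fact_neq0 F k; have fn := fact_neq0 F n.
(* Both sides are (n+k)!, that is (1)_(n+k) split after n or after k factors. *)
have key : n`!%:R * poch n.+1%:R k = k`!%:R * poch (1 + k%:R) n :> F.
  by rewrite -!poch1 -[n.+1%:R]natr1 [_ + 1]addrC -!pochD addnC.
have -> : poch (1 + k%:R) n = n`!%:R * poch n.+1%:R k / k`!%:R :> F.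
  by rewrite key; field.
have : n.+1%:R != 0 :> F by rewrite pnatr_eq0.
move: n.+1%:R => N N0.
by field; rewrite fk fn N0.
Qed.

(** At a = -1 the base 1+a+k is k, and (-n)_k / n! equals (-1)^k / (n-k)!. *)
Lemma kerB_N1 n k : (0 < n)%N -> (k <= n)%N ->
  kerB (- 1 : F) n k =
    (2 * n%:R - 1) * ((-1) ^+ k * poch k%:R n.-1 / ((n - k)`!%:R * k`!%:R)).
Proof.
move=> n_gt0 le_kn; rewrite /kerB gtn_eqF // subrr add0r poch_oppn.
have fk := fact_neq0 F k; have fnk := fact_neq0 F (n - k).
have fnk' : (n ^_ k)%:R != 0 :> F by rewrite pnatr_eq0 -lt0n ffact_gt0.
rewrite -(ffact_fact le_kn) natrM.
by field; rewrite fk fnk fnk'.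
Qed.

End ClosedForms.

Theorem theorem3p2 (R : realType) (a : R[i])
    (ha : forall m : nat, (2 <= m)%N -> a <> - m%:R) :
  exists Linv : {linear omega R -> omega R},
    [/\ cancel (Ltilde a : {linear omega R -> omega R}) Linv,
        cancel Linv (Ltilde a : {linear omega R -> omega R})
      & forall x : omega R,
        [/\ (forall m : nat, a <> - m%:R) ->
            forall n : nat,
              Linv x n =
                poch a n * poch (1 + a / 2) n / (n`!%:R * poch (a / 2) n) *
                \sum_(k < n.+1)
                  poch (- n%:R) k * poch (n%:R + a) k /
                  (k`!%:R * poch (1 + a) k) * x k,
            a = 0 ->
            Linv x 0%N = x 0%N /\
            forall n : nat, (0 < n)%N ->
              Linv x n =
                2 * \sum_(k < n.+1)
                  poch (- n%:R) k * poch n%:R k / (k`!%:R * k`!%:R) * x k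
          & a = -1 ->
            Linv x 0%N = x 0%N /\
            forall n : nat, (0 < n)%N ->
              Linv x n =
                (2 * n%:R - 1) * \sum_(k < n.+1)
                  (-1) ^+ k * poch k%:R n.-1 / ((n - k)`!%:R * k`!%:R) * x k]].
Proof.
have a_neq m : (2 <= m)%N -> a + m%:R != 0.
  by move=> /ha/eqP; rewrite addr_eq0.
(* One kernel serves every admissible a; the three cases only rewrite its entries. *)
exists (lower (kerB a) : {linear omega R -> omega R}); split=> [||x].
- exact: lowerK (kerA_triangular a) (kerBA a_neq).
- exact: lowerK (kerB_triangular a) (kerAB a_neq).
split=> [a_gen n | -> | ->].
- rewrite mulr_sumr; apply: eq_bigr => k _.
  by rewrite kerB_generic ?mulrA // => m; rewrite addr_eq0; apply/eqP.
- split=> [|n n_gt0]; first exact: lowerB0.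
  rewrite mulr_sumr; apply: eq_bigr => k _.
  by rewrite kerB_0 ?mulrA.
- split=> [|n n_gt0]; first exact: lowerB0.
  rewrite mulr_sumr; apply: eq_bigr => k _.
  by rewrite kerB_N1 ?mulrA // -ltnS.
Qed.
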